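(* Let $k$ be a commutative ring, let $A$ be a Hopf subalgebra of a Hopf algebra $E$ over $k$, let $H$ be an $A$-complement of $E$ with associated canonical matched pair $(A,H,\triangleright,\triangleleft)$, and let $\mathbb{H}$ be an arbitrary $A$-complement of $E$. Then there exists an isomorphism of Hopf algebras $\mathbb{H}\cong H_r$ for some deformation map $r:H\to A$ of the matched pair $(A,H,\triangleright,\triangleleft)$.
   Context: All coalgebras, Hopf algebras and tensor products are over a commutative ring $k$; Sweedler notation $\Delta(c)=c_{(1)}\otimes c_{(2)}$ is used. A Hopf subalgebra of $E$ is a Hopf algebra inclusion $A\subseteq E$ that splits $k$-linearly. An $A$-complement of $E$ is a Hopf subalgebra $H\subseteq E$ such that the multiplication map $A\otimes H\to E$, $a\otimes h\mapsto ah$, is bijective. A matched pair of Hopf algebras $(A,H,\triangleright,\triangleleft)$ consists of Hopf algebras $A,H$ and coalgebra maps $\triangleleft:H\otimes A\to H$, $\triangleright:H\otimes A\to A$ such that $(H,\triangleleft)$ is a right $A$-module coalgebra, $(A,\triangleright)$ is a left $H$-module coalgebra, and for all $a,b\in A$, $g,h\in H$: $h\triangleright 1_A=\varepsilon_H(h)1_A$; $1_H\triangleleft a=\varepsilon_A(a)1_H$; $g\triangleright(ab)=(g_{(1)}\triangleright a_{(1)})\bigl((g_{(2)}\triangleleft a_{(2)})\triangleright b\bigr)$; $(gh)\triangleleft a=\bigl(g\triangleleft(h_{(1)}\triangleright a_{(1)})\bigr)(h_{(2)}\triangleleft a_{(2)})$; $g_{(1)}\triangleleft a_{(1)}\otimes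 g_{(2)}\triangleright a_{(2)}=g_{(2)}\triangleleft a_{(2)}\otimes g_{(1)}\triangleright a_{(1)}$. If $H$ is an $A$-complement of $E$, the associated canonical matched pair $(A,H,\triangleright,\triangleleft)$ is the matched pair determined by $ha=(h_{(1)}\triangleright a_{(1)})(h_{(2)}\triangleleft a_{(2)})$ in $E$, for all $a\in A$, $h\in H$; explicitly, if $m:A\otimes H\to E$ is the multiplication map, then $h\triangleright a=(\mathrm{Id}_A\otimes\varepsilon_H)(m^{-1}(ha))$ and $h\triangleleft a=(\varepsilon_A\otimes\mathrm{Id}_H)(m^{-1}(ha))$. A deformation map of a matched pair $(A,H,\triangleright,\triangleleft)$ is a coalgebra map $r:H\to A$ with $r(1_H)=1_A$ which is cocentral, i.e. $r(h_{(1)})\otimes h_{(2)}=r(h_{(2)})\otimes h_{(1)}$ for all $h\in H$, and satisfies, for all $g,h\in H$, $$r\bigl((h\triangleleft r(g_{(1)}))\,g_{(2)}\bigr)=r(h_{(1)})\,\bigl(h_{(2)}\triangleright r(g)\bigr).$$ For a deformation map $r$, the $r$-deformation $H_r$ of $H$ is the Hopf algebra equal to $H$ as a coalgebra, with the same unit $1_H$ and with multiplication $h\bullet g:=\bigl(h\triangleleft r(g_{(1)})\bigr)g_{(2)}$ for all $h,g\in H$. *)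

(* Defs.v *)
From HB Require Import structures.
From mathcomp Require Import all_boot all_order all_algebra.
From mathcomp Require Import boolp classical_sets.

Set Implicit Arguments.
Unset Strict Implicit.
Unset Printing Implicit Defensive.

Import GRing.Theory.
Local Open Scope ring_scope.
Local Open Scope quotient_scope.

(* The tensor product of two k-modules: finite formal sums of pairs (lists)
   modulo the congruence generated by the tensor relations.  Scalars of formal
   sums are absorbed in the first components, and negatives come from
   (- x, y). *)
Section Tensor.
Variables (k : comNzRingType) (M N : lmodType k).

Inductive tensor_eqv : seq (M * N) -> seq (M * N) -> Prop :=
| teqv_refl s : tensor_eqv s s
| teqv_sym s t : tensor_eqv s t -> tensor_eqv t s
| teqv_trans s t u : tensor_eqv s t -> tensor_eqv t u -> tensor_eqv s u
| teqv_cat s s' t t' :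
    tensor_eqv s s' -> tensor_eqv t t' -> tensor_eqv (s ++ t) (s' ++ t')
| teqv_catC s t : tensor_eqv (s ++ t) (t ++ s)
| teqv_0l y : tensor_eqv [:: (0, y)] [::]
| teqv_Dl x x' y : tensor_eqv [:: (x + x', y)] [:: (x, y); (x', y)]
| teqv_Dr x y y' : tensor_eqv [:: (x, y + y')] [:: (x, y); (x, y')]
| teqv_Z a x y : tensor_eqv [:: (a *: x, y)] [:: (x, a *: y)].

Definition tensor_rel (s t : seq (M * N)) : bool := `[< tensor_eqv s t >].

Lemma tensor_rel_refl : reflexive tensor_rel.
Proof. by move=> s; apply/asboolP/teqv_refl. Qed.

Lemma tensor_rel_sym : symmetric tensor_rel.
Proof. by move=> s t; apply/idP/idP => /asboolP/teqv_sym/asboolP. Qed.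

Lemma tensor_rel_trans : transitive tensor_rel.
Proof.
by move=> t s u /asboolP st /asboolP tu; apply/asboolP/(teqv_trans st tu).
Qed.

Canonical tensor_equiv :=
  EquivRel tensor_rel tensor_rel_refl tensor_rel_sym tensor_rel_trans.

Definition tensor : Type := {eq_quot tensor_equiv}.

HB.instance Definition _ := Choice.on tensor.
HB.instance Definition _ := EqQuotient.on tensor.

Lemma tensor_eqP (s t : seq (M * N)) :
  tensor_eqv s t <-> \pi_tensor s = \pi_tensor t.
Proof.
split=> [st|/eqmodP/asboolP//]; apply/eqmodP; exact/asboolP.
Qed.

Lemma tensor_repr (s : seq (M * N)) : tensor_eqv (repr (\pi_tensor s)) s.
Proof. by apply/tensor_eqP; rewrite reprK. Qed.

Definition tensor_add (u v : tensor) : tensor := \pi_tensor (repr u ++ repr v).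

Definition scale_terms (a : k) (s : seq (M * N)) : seq (M * N) :=
  [seq (a *: p.1, p.2) | p <- s].

Definition tensor_scale (a : k) (u : tensor) : tensor :=
  \pi_tensor (scale_terms a (repr u)).

Lemma scale_terms_eqv a s t :
  tensor_eqv s t -> tensor_eqv (scale_terms a s) (scale_terms a t).
Proof.
elim=> {s t} [s|s t _|s t u _ st _|s s' t t' _ ss _ tt|s t|y|x x' y|x y y'|b x y].
- exact: teqv_refl.
- exact: teqv_sym.
- exact: teqv_trans.
- by rewrite /scale_terms !map_cat; apply: teqv_cat.
- by rewrite /scale_terms !map_cat; apply: teqv_catC.
- by rewrite /= scaler0; apply: teqv_0l.
- by rewrite /= scalerDr; apply: teqv_Dl.
- exact: teqv_Dr.
- by rewrite /= scalerA mulrC -scalerA; apply: teqv_Z.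
Qed.

Lemma tensor_addE s t :
  tensor_add (\pi_tensor s) (\pi_tensor t) = \pi_tensor (s ++ t).
Proof. by apply/tensor_eqP; apply: teqv_cat; apply: tensor_repr. Qed.

Lemma tensor_scaleE a s :
  tensor_scale a (\pi_tensor s) = \pi_tensor (scale_terms a s).
Proof. by apply/tensor_eqP; apply/scale_terms_eqv/tensor_repr. Qed.

Lemma scale0_terms s : tensor_eqv (scale_terms 0 s) [::].
Proof.
elim: s => [|[x y] s IHs]; first exact: teqv_refl.
rewrite /= scale0r -cat1s -[[::]]cat0s; apply: teqv_cat IHs; exact: teqv_0l.
Qed.

Lemma scaleD_terms a b s :
  tensor_eqv (scale_terms (a + b) s) (scale_terms a s ++ scale_terms b s).
Proof.
elim: s => [|[x y] s IHs]; first exact: teqv_refl.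
rewrite /= -[X in tensor_eqv X]cat1s.
apply: (teqv_trans (teqv_cat (t' := scale_terms a s ++ scale_terms b s)
  (teqv_refl _) IHs)).
rewrite scalerDl.
apply: (teqv_trans (teqv_cat (teqv_Dl _ _ _) (teqv_refl _))).
rewrite -cat1s -[(a *: x, y) :: scale_terms a s ++ _]cat1s /=.
rewrite -[(a *: x, y) :: _ :: _]cat1s -[X in tensor_eqv _ X]cat1s.
apply: teqv_cat; first exact: teqv_refl.
rewrite -[(b *: x, y) :: _ ++ _]/(((b *: x, y) :: scale_terms a s) ++ _).
rewrite -[(b *: x, y) :: scale_terms b s]cat1s catA.
apply: teqv_cat; last exact: teqv_refl.
rewrite -[(b *: x, y) :: _]cat1s; exact: teqv_catC.
Qed.

Lemma tensor_ind_pi (P : tensor -> Prop) :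
  (forall s, P (\pi_tensor s)) -> forall u, P u.
Proof. by move=> Ppi u; rewrite -[u]reprK. Qed.

Lemma tensor_addA : associative tensor_add.
Proof.
elim/tensor_ind_pi=> s; elim/tensor_ind_pi=> t; elim/tensor_ind_pi=> u.
by rewrite !tensor_addE catA.
Qed.

Lemma tensor_addC : commutative tensor_add.
Proof.
elim/tensor_ind_pi=> s; elim/tensor_ind_pi=> t; rewrite !tensor_addE.
exact/tensor_eqP/teqv_catC.
Qed.

Lemma tensor_add0 : left_id (\pi_tensor [::]) tensor_add.
Proof. by elim/tensor_ind_pi=> s; rewrite tensor_addE. Qed.

Lemma tensor_scale1 : left_id 1 tensor_scale.
Proof.
elim/tensor_ind_pi=> s; rewrite tensor_scaleE; congr (\pi_tensor _).
by rewrite -[RHS]map_id; apply: eq_map => -[x y]; rewrite scale1r.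
Qed.

Lemma tensor_scaleDl u :
  {morph tensor_scale^~ u : a b / a + b >-> tensor_add a b}.
Proof.
move=> a b; elim/tensor_ind_pi: u => s; rewrite !tensor_scaleE tensor_addE.
exact/tensor_eqP/scaleD_terms.
Qed.

Lemma tensor_addN :
  left_inverse (\pi_tensor [::]) (tensor_scale (-1)) tensor_add.
Proof.
move=> u; rewrite -[X in tensor_add _ X]tensor_scale1 -tensor_scaleDl addNr.
elim/tensor_ind_pi: u => s; rewrite tensor_scaleE.
exact/tensor_eqP/scale0_terms.
Qed.

HB.instance Definition _ :=
  GRing.isZmodule.Build tensor tensor_addA tensor_addC tensor_add0 tensor_addN.

Lemma tensor_scaleA a b u :
  tensor_scale a (tensor_scale b u) = tensor_scale (a * b) u.
Proof.
elim/tensor_ind_pi: u => s; rewrite !tensor_scaleE; congr (\pi_tensor _).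
by rewrite /scale_terms -map_comp; apply: eq_map => p /=; rewrite scalerA.
Qed.

Lemma tensor_scaleDr : right_distributive tensor_scale +%R.
Proof.
move=> a; elim/tensor_ind_pi=> s; elim/tensor_ind_pi=> t.
by rewrite [_ + _]tensor_addE !tensor_scaleE [RHS]tensor_addE /scale_terms map_cat.
Qed.

HB.instance Definition _ := GRing.Zmodule_isLmodule.Build k tensor
  tensor_scaleA tensor_scale1 tensor_scaleDr tensor_scaleDl.

Definition tpure (x : M) (y : N) : tensor := \pi_tensor [:: (x, y)].

(* The linear extension sum_i x_i (x) y_i |-> sum_i f x_i y_i.  It is defined
   for every f by choosing a representative, but is only meaningful for
   bilinear f (see tlift_pure and tlift_linear). *)
Definition tlift (P : lmodType k) (f : M -> N -> P) (u : tensor) : P :=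
  \sum_(p <- repr u) f p.1 p.2.

Section Universal.
Variables (P : lmodType k) (f : M -> N -> P).
Hypothesis f_bilin : bilinear_for *:%R *:%R f.

Let lin_0 (V W : lmodType k) (g : V -> W) : linear g -> g 0 = 0.
Proof. by move=> gP; have := gP (-1) 0 0; rewrite scaler0 addr0 scaleN1r addNr. Qed.

Let lin_D (V W : lmodType k) (g : V -> W) x y :
  linear g -> g (x + y) = g x + g y.
Proof. by move=> gP; rewrite -[in LHS](scale1r x) gP scale1r. Qed.

Let lin_Z (V W : lmodType k) (g : V -> W) a x :
  linear g -> g (a *: x) = a *: g x.
Proof. by move=> gP; rewrite -[in LHS](addr0 (a *: x)) gP lin_0 // addr0. Qed.

Lemma tensor_eqv_sum s t : tensor_eqv s t ->
  \sum_(p <- s) f p.1 p.2 = \sum_(p <- t) f p.1 p.2.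
Proof.
case: f_bilin => fl fr.
elim=> {s t} [s|s t _|s t u _ st _|s s' t t' _ ss _ tt|s t|y|x x' y|x y y'|b x y].
- by [].
- by [].
- by rewrite st.
- by rewrite !big_cat ss tt.
- by rewrite !big_cat /= addrC.
- by rewrite big_seq1 big_nil (lin_0 (fl y)).
- by rewrite !big_cons !big_nil !addr0 (lin_D _ _ (fl y)).
- by rewrite !big_cons !big_nil !addr0 (lin_D _ _ (fr x)).
- by rewrite !big_seq1 (lin_Z _ _ (fl y)) (lin_Z _ _ (fr x)).
Qed.

Lemma tlift_pi s : tlift f (\pi_tensor s) = \sum_(p <- s) f p.1 p.2.
Proof. exact/tensor_eqv_sum/tensor_repr. Qed.

Lemma tlift_pure x y : tlift f (tpure x y) = f x y.
Proof. by rewrite tlift_pi big_seq1. Qed.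

Lemma tlift_linear : linear (tlift f).
Proof.
move=> a; elim/tensor_ind_pi=> s; elim/tensor_ind_pi=> t.
rewrite [_ *: _]tensor_scaleE [_ + _]tensor_addE !tlift_pi big_cat big_map.
congr (_ + _); rewrite scaler_sumr; apply: eq_bigr => p _ /=.
by rewrite (lin_Z _ _ (f_bilin.1 _)).
Qed.

End Universal.

Lemma tpure_bilinear : bilinear_for *:%R *:%R tpure.
Proof.
have lin a (x x' : M) (y y' : N) : a *: tpure x y + tpure x' y' =
    \pi_tensor [:: (a *: x, y); (x', y')].
  by rewrite [_ *: _]tensor_scaleE [_ + _]tensor_addE.
split=> [y a x x'|x a y y'] /=; rewrite lin; apply/tensor_eqP => /=.
  exact: teqv_Dl.
apply: (teqv_trans (teqv_Dr _ _ _)).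
rewrite -cat1s -[X in tensor_eqv _ X]cat1s; apply: teqv_cat.
  exact/teqv_sym/teqv_Z.
exact: teqv_refl.
Qed.

Lemma tensor_sum_pure (u : tensor) : u = \sum_(p <- repr u) tpure p.1 p.2.
Proof.
rewrite -[LHS]reprK; elim: (repr u) => [|[x y] s IHs]; first by rewrite big_nil.
by rewrite big_cons -IHs [_ + _]tensor_addE.
Qed.

End Tensor.

Notation "M ⊗ N" := (tensor M N) (at level 40, left associativity) : type_scope.
Notation "x ⊗ y" := (tpure x y) (at level 40, left associativity) : ring_scope.

HB.mixin Record Lmodule_isCoalgebra (k : comNzRingType) C
    of GRing.Lmodule k C := {
  comul : {linear C -> (C ⊗ C)%type};
  counit : {scalar C};
  comulA : forall c,
    tlift (fun x y => tlift (fun x1 x2 => x1 ⊗ (x2 ⊗ y)) (comul x)) (comul c)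
    = tlift (fun x y => x ⊗ comul y) (comul c);
  counit_l : forall c, tlift (fun x y => counit x *: y) (comul c) = c;
  counit_r : forall c, tlift (fun x y => counit y *: x) (comul c) = c
}.

#[short(type="coalgType")]
HB.structure Definition Coalgebra (k : comNzRingType) :=
  {C of GRing.Lmodule k C & Lmodule_isCoalgebra k C}.

(* Sweedler notation: [swd c1 , c2 <- c => F] is F(c_(1), c_(2)), for F
   bilinear in (c1, c2). *)
Notation "[ 'swd' x , y <- c => F ]" := (tlift (fun x y => F) (comul c))
  (at level 0, x name, y name, c at level 99, F at level 200,
   format "[ 'swd'  x ,  y  <-  c  =>  F ]") : ring_scope.

HB.mixin Record Algebra_isHopf (k : comNzRingType) H
    of GRing.Algebra k H & Coalgebra k H := {
  antipode : {linear H -> H};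
  comul1 : comul (1 : H) = 1 ⊗ 1;
  comulM : forall g h : H,
    comul (g * h) =
      [swd g1, g2 <- g => [swd h1, h2 <- h => (g1 * h1) ⊗ (g2 * h2)]];
  counit1 : counit (1 : H) = 1;
  counitM : forall g h : H, counit (g * h) = counit g * counit h;
  antipode_l : forall h : H,
    [swd h1, h2 <- h => antipode h1 * h2] = (counit h)%:A;
  antipode_r : forall h : H,
    [swd h1, h2 <- h => h1 * antipode h2] = (counit h)%:A
}.

#[short(type="hopfAlgType")]
HB.structure Definition HopfAlgebra (k : comNzRingType) :=
  {H of GRing.Algebra k H & Coalgebra k H & Algebra_isHopf k H}.

Section Morphisms.
Variable k : comNzRingType.

Record coalg_morphism (C D : coalgType k) (f : C -> D) : Prop := {
  cmor_linear : linear f;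
  cmor_comul : forall c, comul (f c) = [swd c1, c2 <- c => f c1 ⊗ f c2];
  cmor_counit : forall c, counit (f c) = counit c
}.

Record hopf_morphism (A B : hopfAlgType k) (f : A -> B) : Prop := {
  hmor_coalg : coalg_morphism f;
  hmor_one : f 1 = 1;
  hmor_mul : {morph f : x y / x * y};
  hmor_antipode : {morph f : x / antipode x}
}.

Definition hopf_iso (A B : hopfAlgType k) (f : A -> B) : Prop :=
  hopf_morphism f /\ bijective f.

(* A Hopf subalgebra of E is given by its inclusion map i : A -> E. *)
Record hopf_subalgebra (A E : hopfAlgType k) (i : A -> E) : Prop := {
  hsub_morphism : hopf_morphism i;
  hsub_inj : injective i;
  hsub_split : exists p : {linear E -> A}, cancel i p
}.

End Morphisms.

Section Complements.
Variables (k : comNzRingType) (E A H : hopfAlgType k).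
Variables (iA : A -> E) (iH : H -> E).

Definition mul_map (t : (A ⊗ H)%type) : E :=
  tlift (fun a h => iA a * iH h) t.

(* iA is the inclusion of A and iH that of its complement H. *)
Definition is_complement : Prop :=
  hopf_subalgebra iH /\ bijective mul_map.

(* This is the inverse of mul_map when the latter is bijective. *)
Definition mul_map_inv (e : E) : (A ⊗ H)%type :=
  xget 0 [set t | mul_map t = e]%classic.

Definition canonical_lact (h : H) (a : A) : A :=
  tlift (fun (a' : A) (h' : H) => counit h' *: a') (mul_map_inv (iH h * iA a)).

Definition canonical_ract (h : H) (a : A) : H :=
  tlift (fun (a' : A) (h' : H) => counit a' *: h') (mul_map_inv (iH h * iA a)).

End Complements.

Section MatchedPairs.
Variables (k : comNzRingType) (A H : hopfAlgType k).
Variables (lact : H -> A -> A) (ract : H -> A -> H).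

Local Notation "h ▷ a" := (lact h a) (at level 39, no associativity).
Local Notation "h ◁ a" := (ract h a) (at level 39, no associativity).

(* The k-linear maps H ⊗ A -> A and H ⊗ A -> H are given as bilinear maps, and
   H ⊗ A has the comultiplication
   h ⊗ a |-> (h_(1) ⊗ a_(1)) ⊗ (h_(2) ⊗ a_(2)). *)
Record matched_pair : Prop := {
  lact_bilinear : bilinear_for *:%R *:%R lact;
  lact_comul : forall h a,
    comul (h ▷ a) =
      [swd h1, h2 <- h => [swd a1, a2 <- a => (h1 ▷ a1) ⊗ (h2 ▷ a2)]];
  lact_counit : forall h a, counit (h ▷ a) = counit h * counit a;
  ract_bilinear : bilinear_for *:%R *:%R ract;
  ract_comul : forall h a,
    comul (h ◁ a) =
      [swd h1, h2 <- h => [swd a1, a2 <- a => (h1 ◁ a1) ⊗ (h2 ◁ a2)]];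
  ract_counit : forall h a, counit (h ◁ a) = counit h * counit a;
  lact_1l : forall a, 1 ▷ a = a;
  lact_Ml : forall g h a, (g * h) ▷ a = g ▷ (h ▷ a);
  ract_1r : forall h, h ◁ 1 = h;
  ract_Mr : forall h a b, h ◁ (a * b) = (h ◁ a) ◁ b;
  lact_1r : forall h, h ▷ 1 = (counit h)%:A;
  ract_1l : forall a, 1 ◁ a = (counit a)%:A;
  lact_Mr : forall g a b,
    g ▷ (a * b) =
      [swd g1, g2 <- g => [swd a1, a2 <- a => (g1 ▷ a1) * ((g2 ◁ a2) ▷ b)]];
  ract_Ml : forall g h a,
    (g * h) ◁ a =
      [swd h1, h2 <- h => [swd a1, a2 <- a => (g ◁ (h1 ▷ a1)) * (h2 ◁ a2)]];
  act_compat : forall g a,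
    [swd g1, g2 <- g => [swd a1, a2 <- a => (g1 ◁ a1) ⊗ (g2 ▷ a2)]] =
    [swd g1, g2 <- g => [swd a1, a2 <- a => (g2 ◁ a2) ⊗ (g1 ▷ a1)]]
}.

Definition deform_mul (r : H -> A) (h g : H) : H :=
  [swd g1, g2 <- g => (h ◁ r g1) * g2].

Record deformation_map (r : H -> A) : Prop := {
  defm_pair : matched_pair;
  defm_coalg : coalg_morphism r;
  defm_one : r 1 = 1;
  defm_cocentral : forall h,
    [swd h1, h2 <- h => r h1 ⊗ h2] = [swd h1, h2 <- h => r h2 ⊗ h1];
  defm_mul : forall g h,
    [swd g1, g2 <- g => r ((h ◁ r g1) * g2)] =
      [swd h1, h2 <- h => r h1 * (h2 ▷ r g)]
}.

End MatchedPairs.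

(* What is needed to make the coalgebra C a Hopf algebra with prescribed unit
   and multiplication.  The antipode, although a field, is unique. *)
Record hopf_structure (k : comNzRingType) (C : coalgType k) (one : C)
    (mul : C -> C -> C) := HopfStructure {
  hs_mulA : associative mul;
  hs_mul1l : left_id one mul;
  hs_mul1r : right_id one mul;
  hs_bilinear : bilinear_for *:%R *:%R mul;
  hs_comul1 : comul one = one ⊗ one;
  hs_comulM : forall g h,
    comul (mul g h) =
      [swd g1, g2 <- g => [swd h1, h2 <- h => mul g1 h1 ⊗ mul g2 h2]];
  hs_counit1 : counit one = 1;
  hs_counitM : forall g h, counit (mul g h) = counit g * counit h;
  hs_antipode : {linear C -> C};
  hs_antipode_l : forall h,
    [swd h1, h2 <- h => mul (hs_antipode h1) h2] = counit h *: one;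
  hs_antipode_r : forall h,
    [swd h1, h2 <- h => mul h1 (hs_antipode h2)] = counit h *: one
}.

(* A copy of the coalgebra C, as a Hopf algebra with the structure S. *)
Definition hopf_of (k : comNzRingType) (C : coalgType k) (one : C)
  (mul : C -> C -> C) (S : hopf_structure one mul) : Type := C.

Section HopfOf.
Variables (k : comNzRingType) (C : coalgType k) (one : C) (mul : C -> C -> C).
Variable S : hopf_structure one mul.

HB.instance Definition _ := Coalgebra.copy (hopf_of S) C.

Let mulDl : left_distributive mul +%R.
Proof.
move=> x y z; have := (hs_bilinear S).1 z 1 x y.
by rewrite /= !scale1r; apply.
Qed.

Let mulDr : right_distributive mul +%R.
Proof.
move=> x y z; have := (hs_bilinear S).2 x 1 y z.
by rewrite /= !scale1r; apply.
Qed.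

Let one_neq0 : one != 0.
Proof.
apply/eqP => one0; have := hs_counit1 S.
by rewrite one0 linear0 => /eqP; rewrite eq_sym oner_eq0.
Qed.

HB.instance Definition _ := GRing.Zmodule_isNzRing.Build (hopf_of S)
  (hs_mulA S) (hs_mul1l S) (hs_mul1r S) mulDl mulDr one_neq0.

Let mul0l x : mul 0 x = 0.
Proof. exact: (mul0r (x : hopf_of S)). Qed.

Let mul0r x : mul x 0 = 0.
Proof. exact: (mulr0 (x : hopf_of S)). Qed.

Let scaleAl (a : k) (u v : hopf_of S) : a *: (u * v) = (a *: u) * v.
Proof.
have := (hs_bilinear S).1 v a u 0.
by rewrite mul0l !addr0.
Qed.

Let scaleAr (a : k) (u v : hopf_of S) : a *: (u * v) = u * (a *: v).
Proof.
have := (hs_bilinear S).2 u a v 0.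
by rewrite mul0r !addr0.
Qed.

HB.instance Definition _ :=
  GRing.Lmodule_isLalgebra.Build k (hopf_of S) scaleAl.
HB.instance Definition _ :=
  GRing.Lalgebra_isAlgebra.Build k (hopf_of S) scaleAr.
HB.instance Definition _ := Algebra_isHopf.Build k (hopf_of S)
  (hs_comul1 S) (hs_comulM S) (hs_counit1 S) (hs_counitM S)
  (hs_antipode_l S) (hs_antipode_r S).

End HopfOf.

(* Main.v *)
Require Import Defs.
From HB Require Import structures.
From mathcomp Require Import all_boot all_order all_algebra.
From mathcomp Require Import boolp classical_sets.
Import GRing.Theory.
Local Open Scope ring_scope.

(** Let HH be a second complement of A in E.  Since the multiplication
    A ⊗ H -> E is an isomorphism of coalgebras, applying a counit to one tensor
    factor gives coalgebra maps [projA] : E -> A and [projH] : E -> H, and every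
    e in E satisfies e = projA(e_(1)) projH(e_(2)) ([compl_decomp]).  Moreover
    the legs may be interchanged in projA(e_(1)) ⊗ projH(e_(2))
    ([proj_cocentral]).

    Restricting to HH gives coalgebra maps u : HH -> A and v : HH -> H with
    x = u(x_(1)) v(x_(2)) in E.  Let w : H -> HH be the restriction to H of the
    projection that belongs to the complement HH.  That projection sends a e to
    ε(a) times the image of e, for a in A; applying it to x = u(x_(1)) v(x_(2))
    gives x = w(v(x)).  The situation is symmetric in H and HH, so also
    v(w(h)) = h ([compl_change_K]), and v is an isomorphism of coalgebras.

    The deformation map is r = u w, that is, w(h) = r(h_(1)) h_(2) in E.  The
    projections of a product in E can be computed from those of its factors
    ([projA_mul], [projH_mul]):

      projA(d e) = projA(d_(1)) (projH(d_(2)) ▷ projA(e)),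
      projH(d e) = (projH(d) ◁ projA(e_(1))) projH(e_(2)).

    For d = w(h) and e = w(g), the second identity says that v(w(h) w(g)) is the
    deformed product h • g, so H_r is nothing but the Hopf algebra structure of
    HH carried along v ([hopf_transport]), and all its laws come for free.  The
    first identity, which computes r(h • g) = u(w(h) w(g)), is then the equation
    of a deformation map.  The same two identities, applied to products of
    elements of A and H, yield the compatibility laws of the canonical matched
    pair ([canonical_matched_pair]). *)

Set Implicit Arguments.
Unset Strict Implicit.
Unset Printing Implicit Defensive.

(** * Linearity of expressions *)

(** Linearity is treated here as a property of bare functions, because inclusions
    and actions come as functions satisfying predicates and not as bundled
    linear maps. *)

Section Linearity.
Variables (k : comNzRingType) (U V W : lmodType k).

Lemma linear_map0 (f : V -> W) : linear f -> f 0 = 0.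
Proof. by move=> fP; have := fP (-1) 0 0; rewrite scaler0 addr0 scaleN1r addNr. Qed.

Lemma linear_mapZ (f : V -> W) a x : linear f -> f (a *: x) = a *: f x.
Proof. by move=> fP; rewrite -[a *: x]addr0 fP linear_map0 ?addr0. Qed.

Lemma linear_map_sum (f : V -> W) (I : Type) (s : seq I) (g : I -> V) :
  linear f -> f (\sum_(i <- s) g i) = \sum_(i <- s) f (g i).
Proof.
move=> fP; apply: (big_morph f _ (linear_map0 fP)) => x y.
by rewrite -[x]scale1r fP !scale1r.
Qed.

Lemma lin_id : linear (fun x : U => x).
Proof. by []. Qed.

Lemma lin_comp (g : V -> W) (f : U -> V) :
  linear g -> linear f -> linear (fun x => g (f x)).
Proof. by move=> gP fP a x y; rewrite fP gP. Qed.

Lemma lin_mull (R : algType k) (f : U -> R) (c : R) :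
  linear f -> linear (fun x => f x * c).
Proof. by move=> fP a x y; rewrite fP mulrDl scalerAl. Qed.

Lemma lin_mulr (R : algType k) (f : U -> R) (c : R) :
  linear f -> linear (fun x => c * f x).
Proof. by move=> fP a x y; rewrite fP mulrDr scalerAr. Qed.

Lemma lin_purel (f : U -> V) (c : W) : linear f -> linear (fun x => f x ⊗ c).
Proof. by move=> fP a x y; rewrite fP (tpure_bilinear V W).1. Qed.

Lemma lin_purer (f : U -> V) (c : W) : linear f -> linear (fun x => c ⊗ f x).
Proof. by move=> fP a x y; rewrite fP (tpure_bilinear W V).2. Qed.

Lemma lin_scale (b : k) (f : U -> V) : linear f -> linear (fun x => b *: f x).
Proof. by move=> fP a x y; rewrite fP scalerDr !scalerA mulrC. Qed.

Lemma lin_counit (C : coalgType k) (f : U -> C) (v : V) :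
  linear f -> linear (fun x => counit (f x) *: v).
Proof. by move=> fP a x y; rewrite fP linearP scalerDl scalerA. Qed.

(** The tensor [t] does not vary, so its chosen representative is fixed, and the
    lift is a finite sum of linear maps. *)
Lemma lin_tlift (P : lmodType k) (F : P -> U -> V -> W) (t : (U ⊗ V)%type) :
  (forall x y, linear (fun z => F z x y)) -> linear (fun z => tlift (F z) t).
Proof.
move=> FP a x y; rewrite /tlift scaler_sumr -big_split /=.
by apply: eq_bigr => p _; rewrite FP.
Qed.

Lemma lin_tliftr (P : lmodType k) (f : U -> V -> W) (g : P -> (U ⊗ V)%type) :
  bilinear_for *:%R *:%R f -> linear g -> linear (fun z => tlift f (g z)).
Proof. by move=> fP gP a x y; rewrite gP tlift_linear. Qed.

End Linearity.

Lemma tpureZl (k : comNzRingType) (V W : lmodType k) b (x : V) (y : W) :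
  (b *: x) ⊗ y = b *: (x ⊗ y).
Proof. by rewrite (linear_mapZ b x ((tpure_bilinear V W).1 y)). Qed.

Lemma tpureZr (k : comNzRingType) (V W : lmodType k) b (x : V) (y : W) :
  x ⊗ (b *: y) = b *: (x ⊗ y).
Proof. by rewrite (linear_mapZ b y ((tpure_bilinear V W).2 x)). Qed.

(** [lin] proves linearity and bilinearity of Sweedler expressions by following
    their syntax.  Functions that are not primitive operations are looked up in
    the context, or else must have a canonical linear structure. *)
Ltac lin_hyp := cbv beta;
  first [done | exact: linearP
  | match goal with
    | H : bilinear_for _ _ ?F |- GRing.linear_for _ (fun z => ?F z ?c) => exact: (H.1 c)
    | H : bilinear_for _ _ ?F |- GRing.linear_for _ (?F ?c) => exact: (H.2 c)
    end].

Ltac lin := cbv beta;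
  lazymatch goal with
  | |- bilinear_for _ _ _ => first [done | split=> ? /=; lin]
  | |- GRing.linear_for _ (fun x => x) => exact: lin_id
  (* In a binary operation only one operand may depend on the variable; the
     lemma for the wrong side fails to unify. *)
  | |- GRing.linear_for _ (fun x => @?f x * @?g x) =>
      first [apply: (@lin_mull _ _ _ f _) | apply: (@lin_mulr _ _ _ g _)]; lin
  | |- GRing.linear_for _ (fun x => @?f x ⊗ @?g x) =>
      first [apply: (@lin_purel _ _ _ _ f _) | apply: (@lin_purer _ _ _ _ g _)]; lin
  | |- GRing.linear_for _ (fun x => @?f x *: @?g x) =>
      first [apply: (@lin_scale _ _ _ _ g) | apply: lin_counit]; lin
  | |- GRing.linear_for _ (fun z => tlift (@?F z) (@?t z)) =>
      first [apply: (@lin_tlift _ _ _ _ _ F _) => ? ?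
            | apply: (@lin_tliftr _ _ _ _ _ _ t)]; lin
  | |- _ =>
      first
      [ lin_hyp
      | lazymatch goal with |- GRing.linear_for _ (fun x => ?g (@?f x)) =>
          apply: (lin_comp (g := g) (f := f)); [lin_hyp | lin] end
      | lazymatch goal with |- GRing.linear_for _ (fun x => ?F (@?f x) ?c) =>
          apply: (lin_comp (g := fun z => F z c) (f := f)); [lin_hyp | lin] end]
  end.

(** * Sweedler calculus *)

Section Tlift.
Variables (k : comNzRingType) (M N : lmodType k).

Lemma eq_tlift (P : lmodType k) (f g : M -> N -> P) t :
  (forall x y, f x y = g x y) -> tlift f t = tlift g t.
Proof. by move=> fg; apply: eq_bigr => p _. Qed.

(** A linear map commutes with the finite sum over the chosen representative,
    whichever it is. *)
Lemma linear_tlift (P Q : lmodType k) (g : P -> Q) (f : M -> N -> P) t :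
  linear g -> g (tlift f t) = tlift (fun x y => g (f x y)) t.
Proof. exact: linear_map_sum. Qed.

Lemma tlift_tlift (M' N' P : lmodType k) (f : M' -> N' -> P)
    (g : M -> N -> M') (h : M -> N -> N') t :
  bilinear_for *:%R *:%R f ->
  tlift f (tlift (fun x y => g x y ⊗ h x y) t) =
  tlift (fun x y => f (g x y) (h x y)) t.
Proof.
move=> fP; rewrite (linear_tlift _ _ (tlift_linear fP)).
by apply: eq_tlift => x y; rewrite tlift_pure.
Qed.

Lemma exchange_tlift (M' N' P : lmodType k) (F : M -> N -> M' -> N' -> P) s t :
  tlift (fun x y => tlift (F x y) t) s =
  tlift (fun x' y' => tlift (fun x y => F x y x' y') s) t.
Proof. exact: exchange_big. Qed.

Lemma tlift_id (t : (M ⊗ N)%type) : tlift (fun x y => x ⊗ y) t = t.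
Proof. exact: esym (tensor_sum_pure t). Qed.

End Tlift.

Section Sweedler.
Variables (k : comNzRingType) (C : coalgType k) (P : lmodType k).

Lemma swd_counitl (F : C -> P) c :
  linear F -> [swd x, y <- c => counit x *: F y] = F c.
Proof.
move=> FP; rewrite -[in RHS](counit_l c) (linear_tlift _ _ FP).
by apply: eq_tlift => x y; rewrite linear_mapZ.
Qed.

Lemma swd_counitr (F : C -> P) c :
  linear F -> [swd x, y <- c => counit y *: F x] = F c.
Proof.
move=> FP; rewrite -[in RHS](counit_r c) (linear_tlift _ _ FP).
by apply: eq_tlift => x y; rewrite linear_mapZ.
Qed.

End Sweedler.

Lemma counitZ (k : comNzRingType) (C : coalgType k) b (c : C) :
  counit (b *: c) = b * counit c.
Proof. exact: linearZ. Qed.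

Lemma swd_morph (k : comNzRingType) (C D : coalgType k) (f : C -> D)
    (P : lmodType k) (F : D -> D -> P) c :
  coalg_morphism f -> bilinear_for *:%R *:%R F ->
  [swd x, y <- f c => F x y] = [swd x, y <- c => F (f x) (f y)].
Proof. by move=> fP FP; rewrite (cmor_comul fP) tlift_tlift. Qed.

Lemma swd_mul (k : comNzRingType) (E : hopfAlgType k) (P : lmodType k)
    (F : E -> E -> P) (d e : E) : bilinear_for *:%R *:%R F ->
  [swd x, y <- d * e => F x y] =
  [swd d1, d2 <- d => [swd e1, e2 <- e => F (d1 * e1) (d2 * e2)]].
Proof.
move=> FP; rewrite comulM (linear_tlift _ _ (tlift_linear FP)).
by apply: eq_tlift => d1 d2; rewrite tlift_tlift.
Qed.

(** * The two projections attached to a complement *)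

Section Complement.
Variables (k : comNzRingType) (E A H : hopfAlgType k).
Variables (iA : A -> E) (iH : H -> E).
Hypotheses (iAP : hopf_morphism iA) (iHP : hopf_morphism iH).
Hypothesis bij_mul : bijective (mul_map iA iH).

Let iA_lin : linear iA := cmor_linear (hmor_coalg iAP).
Let iH_lin : linear iH := cmor_linear (hmor_coalg iHP).
Let iA1 := hmor_one iAP.
Let iH1 := hmor_one iHP.
Let iAM := hmor_mul iAP.
Let iHM := hmor_mul iHP.
Let iAZ b a : iA (b *: a) = b *: iA a.
Proof. exact: linear_mapZ. Qed.
Let iHZ b h : iH (b *: h) = b *: iH h.
Proof. exact: linear_mapZ. Qed.

(** These are Id ⊗ ε and ε ⊗ Id after the inverse of the multiplication, so that
    the canonical actions are, by definition, the projections of the products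
    [iH h * iA a]. *)
Definition projA (e : E) : A :=
  tlift (fun a h => counit h *: a) (mul_map_inv iA iH e).
Definition projH (e : E) : H :=
  tlift (fun a h => counit a *: h) (mul_map_inv iA iH e).

Local Notation mi := (mul_map_inv iA iH).

Lemma mul_map_linear : linear (mul_map iA iH).
Proof. apply: tlift_linear; lin. Qed.

Lemma mul_map_invK : cancel mi (mul_map iA iH).
Proof.
move=> e; rewrite /mul_map_inv; case: xgetP => [t _ //|] none.
by case: bij_mul => g _ gK; case: (none (g e)); rewrite /= gK.
Qed.

Lemma mul_mapK : cancel (mul_map iA iH) mi.
Proof. by move=> t; apply: (bij_inj bij_mul); rewrite mul_map_invK. Qed.

Lemma mul_map_inv_linear : linear mi.
Proof.
move=> a x y; apply: (bij_inj bij_mul).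
by rewrite mul_map_linear !mul_map_invK.
Qed.

Lemma mul_map_pure a h : mul_map iA iH (a ⊗ h) = iA a * iH h.
Proof. rewrite /mul_map tlift_pure //; lin. Qed.

Lemma projA_linear : linear projA.
Proof.
have miP := mul_map_inv_linear; rewrite /projA; lin.
Qed.

Lemma projH_linear : linear projH.
Proof.
have miP := mul_map_inv_linear; rewrite /projH; lin.
Qed.

Lemma projA_pure a h : projA (iA a * iH h) = counit h *: a.
Proof. rewrite /projA -mul_map_pure mul_mapK tlift_pure //; lin. Qed.

Lemma projH_pure a h : projH (iA a * iH h) = counit a *: h.
Proof. rewrite /projH -mul_map_pure mul_mapK tlift_pure //; lin. Qed.

(** The products [iA a * iH h] span E; this reduces each identity below to a
    computation with [projA_pure] and [projH_pure]. *)
Lemma compl_ext (P : lmodType k) (f g : E -> P) :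
  linear f -> linear g ->
  (forall a h, f (iA a * iH h) = g (iA a * iH h)) -> f =1 g.
Proof.
move=> fP gP fg e; rewrite -(mul_map_invK e) /mul_map !linear_tlift //.
exact: eq_tlift.
Qed.

Let projA_lin := projA_linear.
Let projH_lin := projH_linear.

Lemma swd_iA (P : lmodType k) (F : E -> E -> P) a : bilinear_for *:%R *:%R F ->
  [swd x, y <- iA a => F x y] = [swd x, y <- a => F (iA x) (iA y)].
Proof. exact/swd_morph/(hmor_coalg iAP). Qed.

Lemma swd_iH (P : lmodType k) (F : E -> E -> P) h : bilinear_for *:%R *:%R F ->
  [swd x, y <- iH h => F x y] = [swd x, y <- h => F (iH x) (iH y)].
Proof. exact/swd_morph/(hmor_coalg iHP). Qed.

Lemma swd_compl (P : lmodType k) (F : E -> E -> P) a h :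
  bilinear_for *:%R *:%R F ->
  [swd x, y <- iA a * iH h => F x y] =
  [swd a1, a2 <- a => [swd h1, h2 <- h => F (iA a1 * iH h1) (iA a2 * iH h2)]].
Proof.
move=> FP; have F1 := FP.1; have F2 := FP.2; rewrite swd_mul // swd_iA.
  by apply: eq_tlift => a1 a2; rewrite swd_iH //; lin.
lin.
Qed.

Lemma projA_comul e : comul (projA e) = [swd x, y <- e => projA x ⊗ projA y].
Proof.
move: e; apply: compl_ext; [lin|lin|] => a h /=.
rewrite projA_pure linear_mapZ; last exact: linearP.
rewrite swd_compl; last lin.
rewrite -[in LHS](tlift_id (comul a)) linear_tlift; last lin.
apply: eq_tlift => a1 a2.
rewrite -(@swd_counitl _ _ _ (fun h => counit h *: (a1 ⊗ a2))); last lin.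
by apply: eq_tlift => h1 h2; rewrite !projA_pure tpureZl tpureZr.
Qed.

Lemma projH_comul e : comul (projH e) = [swd x, y <- e => projH x ⊗ projH y].
Proof.
move: e; apply: compl_ext; [lin|lin|] => a h /=.
rewrite projH_pure linear_mapZ; last exact: linearP.
rewrite swd_compl; last lin.
rewrite exchange_tlift -[in LHS](tlift_id (comul h)) linear_tlift; last lin.
apply: eq_tlift => h1 h2.
rewrite -(@swd_counitl _ _ _ (fun a => counit a *: (h1 ⊗ h2))); last lin.
by apply: eq_tlift => a1 a2; rewrite !projH_pure tpureZl tpureZr.
Qed.

Lemma counit_pure a h : counit (iA a * iH h) = counit a * counit h.
Proof.
by rewrite counitM (cmor_counit (hmor_coalg iAP)) (cmor_counit (hmor_coalg iHP)).
Qed.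

Lemma projA_counit e : counit (projA e) = counit e.
Proof.
(* The scalars are moved into the algebra, where they are values of maps
   between modules. *)
suff /(congr1 counit) : (counit (projA e))%:A = (counit e)%:A :> A.
  by rewrite !counitZ counit1 !mulr1.
move: e; apply: compl_ext; [lin|lin|] => a h.
by rewrite projA_pure counit_pure counitZ mulrC.
Qed.

Lemma projH_counit e : counit (projH e) = counit e.
Proof.
suff /(congr1 counit) : (counit (projH e))%:A = (counit e)%:A :> A.
  by rewrite !counitZ counit1 !mulr1.
move: e; apply: compl_ext; [lin|lin|] => a h.
by rewrite projH_pure counit_pure counitZ.
Qed.

Lemma projA_coalg : coalg_morphism projA.
Proof. split; [exact: projA_lin | exact: projA_comul | exact: projA_counit]. Qed.

Lemma projH_coalg : coalg_morphism projH.
Proof. split; [exact: projH_lin | exact: projH_comul | exact: projH_counit]. Qed.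

(** For e = a h the sum is ε(h_(1)) ε(a_(2)) a_(1) h_(2), which the counit laws
    collapse to a h. *)
Lemma compl_decomp e : [swd x, y <- e => iA (projA x) * iH (projH y)] = e.
Proof.
move: e; apply: compl_ext; [lin|lin|].
move=> a h /=; rewrite swd_compl; last lin.
rewrite -[in RHS](@swd_counitr _ _ _ (fun a => iA a * iH h)); last lin.
apply: eq_tlift => a1 a2.
rewrite -(@swd_counitl _ _ _ (fun h => counit a2 *: (iA a1 * iH h))); last lin.
apply: eq_tlift => h1 h2; rewrite projA_pure projH_pure iAZ iHZ.
by rewrite -scalerAl -scalerAr.
Qed.

(** For e = a h both sides are a ⊗ h: the projections apply the counit to one leg
    of a and to one leg of h, and it does not matter to which one.  This is the
    source both of the symmetry axiom of the matched pair and of the cocentrality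
    of the deformation map. *)
Lemma proj_cocentral e :
  [swd x, y <- e => projA x ⊗ projH y] = [swd x, y <- e => projA y ⊗ projH x].
Proof.
have pures x y x' y' : projA (iA x * iH y) ⊗ projH (iA x' * iH y') =
    counit y *: (counit x' *: (x ⊗ y')).
  by rewrite projA_pure projH_pure tpureZl tpureZr.
move: e; apply: compl_ext; [lin|lin|].
move=> a h /=; rewrite !swd_compl; [|lin|lin].
transitivity (a ⊗ h).
  rewrite -(@swd_counitr _ _ _ (fun a => a ⊗ h)); last lin.
  apply: eq_tlift => a1 a2.
  rewrite -(@swd_counitl _ _ _ (fun h => counit a2 *: (a1 ⊗ h))); last lin.
  by apply: eq_tlift => h1 h2; rewrite pures.
rewrite -[LHS](@swd_counitl _ _ _ (fun a => a ⊗ h)); last lin.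
apply: eq_tlift => a1 a2.
rewrite -(@swd_counitr _ _ _ (fun h => counit a1 *: (a2 ⊗ h))); last lin.
by apply: eq_tlift => h1 h2; rewrite pures.
Qed.

Lemma proj_cocentral_bilin (P : lmodType k) (F : A -> H -> P) e :
  bilinear_for *:%R *:%R F ->
  [swd x, y <- e => F (projA x) (projH y)] =
  [swd x, y <- e => F (projA y) (projH x)].
Proof.
move=> FP; rewrite -(tlift_tlift (fun x _ => projA x) (fun _ y => projH y)) //.
rewrite proj_cocentral.
by rewrite (tlift_tlift (fun _ y => projA y) (fun x _ => projH x)).
Qed.

Lemma projA_iA a : projA (iA a) = a.
Proof. by rewrite -[iA a]mulr1 -iH1 projA_pure counit1 scale1r. Qed.

Lemma projH_iA a : projH (iA a) = (counit a)%:A.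
Proof. by rewrite -[iA a]mulr1 -iH1 projH_pure. Qed.

Lemma projA_iH h : projA (iH h) = (counit h)%:A.
Proof. by rewrite -[iH h]mul1r -iA1 projA_pure. Qed.

Lemma projH_iH h : projH (iH h) = h.
Proof. by rewrite -[iH h]mul1r -iA1 projH_pure counit1 scale1r. Qed.

Lemma projA_mulH e h : projA (e * iH h) = counit h *: projA e.
Proof.
move: e; apply: compl_ext; [lin|lin|] => a h'.
by rewrite -mulrA -iHM !projA_pure counitM scalerA mulrC.
Qed.

Lemma projH_mulA a e : projH (iA a * e) = counit a *: projH e.
Proof.
move: e; apply: compl_ext; [lin|lin|] => a' h.
by rewrite mulrA -iAM !projH_pure counitM scalerA.
Qed.

Lemma projA_mulA a e : projA (iA a * e) = a * projA e.
Proof.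
move: e; apply: compl_ext; [lin|lin|] => a' h.
by rewrite mulrA -iAM !projA_pure scalerAr.
Qed.

Lemma projH_mulH e h : projH (e * iH h) = projH e * h.
Proof.
move: e; apply: compl_ext; [lin|lin|] => a h'.
by rewrite -mulrA -iHM !projH_pure scalerAl.
Qed.

(** The kernel of [projA] is a left ideal: for e = a h, the factor h on the far
    right only contributes the scalar ε(h). *)
Lemma projA_mulr d e : projA (d * e) = projA (d * iA (projA e)).
Proof.
move: e; apply: compl_ext; [lin|lin|] => a h.
by rewrite mulrA projA_mulH projA_pure iAZ -scalerAr (linear_mapZ _ _ projA_lin).
Qed.

(** The mirror image of [projA_mulr]: the kernel of [projH] is a right ideal. *)
Lemma projH_mull d e : projH (d * e) = projH (iH (projH d) * e).
Proof.
move: d; apply: compl_ext; [lin|lin|] => a h.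
by rewrite -mulrA projH_mulA projH_pure iHZ -scalerAl (linear_mapZ _ _ projH_lin).
Qed.

(** Decompose d as projA(d_(1)) projH(d_(2)): the first factor comes out of
    [projA] on the left, and of e only [projA e] matters. *)
Lemma projA_mul d e :
  projA (d * e) =
  [swd d1, d2 <- d => projA d1 * projA (iH (projH d2) * iA (projA e))].
Proof.
rewrite -[in LHS](compl_decomp d).
have mulP : linear (fun d => projA (d * e)) by lin.
rewrite (linear_tlift _ _ mulP).
by apply: eq_tlift => d1 d2; rewrite -mulrA projA_mulA (projA_mulr _ e).
Qed.

(** Decompose e as projA(e_(1)) projH(e_(2)): the last factor comes out of
    [projH] on the right, and of d only [projH d] matters. *)
Lemma projH_mul d e :
  projH (d * e) =
  [swd e1, e2 <- e => projH (iH (projH d) * iA (projA e1)) * projH e2].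
Proof.
rewrite -[in LHS](compl_decomp e).
have mulP : linear (fun e => projH (d * e)) by lin.
rewrite (linear_tlift _ _ mulP).
by apply: eq_tlift => e1 e2; rewrite mulrA projH_mulH (projH_mull d).
Qed.

(** * The canonical matched pair *)

Local Notation lact := (canonical_lact iA iH).
Local Notation ract := (canonical_ract iA iH).

Lemma swd_mul_HA (P : lmodType k) (F : E -> E -> P) h a :
  bilinear_for *:%R *:%R F ->
  [swd x, y <- iH h * iA a => F x y] =
  [swd h1, h2 <- h => [swd a1, a2 <- a => F (iH h1 * iA a1) (iH h2 * iA a2)]].
Proof.
move=> FP; have F1 := FP.1; have F2 := FP.2; rewrite swd_mul // swd_iH.
  by apply: eq_tlift => h1 h2; rewrite swd_iA //; lin.
lin.
Qed.

(** Both actions are projections of the product h a in E.  Associativity of E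
    together with [projA_mulr] and [projH_mull] gives the module laws, and with
    [projA_mul] and [projH_mul] the two rules for acting with or on a product. *)
Lemma canonical_matched_pair : matched_pair lact ract.
Proof.
suff : matched_pair (fun h a => projA (iH h * iA a))
                    (fun h a => projH (iH h * iA a)) by [].
split.
- lin.
- move=> h a; rewrite projA_comul swd_mul_HA //; lin.
- move=> h a; rewrite projA_counit counitM.
  by rewrite (cmor_counit (hmor_coalg iAP)) (cmor_counit (hmor_coalg iHP)).
- lin.
- move=> h a; rewrite projH_comul swd_mul_HA //; lin.
- move=> h a; rewrite projH_counit counitM.
  by rewrite (cmor_counit (hmor_coalg iAP)) (cmor_counit (hmor_coalg iHP)).
- by move=> a; rewrite iH1 mul1r projA_iA.
- by move=> g h a; rewrite iHM -mulrA (projA_mulr (iH g)).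
- by move=> h; rewrite iA1 mulr1 projH_iH.
- by move=> h a b; rewrite iAM mulrA (projH_mull (iH h * iA a)).
- by move=> h; rewrite iA1 mulr1 projA_iH.
- by move=> a; rewrite iH1 mul1r projH_iA.
- move=> g a b; rewrite iAM mulrA projA_mul projA_iA swd_mul_HA //; lin.
- move=> g h a; rewrite iHM -mulrA projH_mul projH_iH swd_mul_HA //; lin.
- move=> g a.
  rewrite -(swd_mul_HA (F := fun x y => projH x ⊗ projA y)); last lin.
  rewrite -(swd_mul_HA (F := fun x y => projH y ⊗ projA x)); last lin.
  by rewrite (proj_cocentral_bilin (F := fun a h => h ⊗ a)) //; lin.
Qed.

End Complement.

(** * Transport of a Hopf algebra structure *)

Lemma coalg_morphism_comp (k : comNzRingType) (B C D : coalgType k)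
    (g : C -> D) (f : B -> C) :
  coalg_morphism g -> coalg_morphism f -> coalg_morphism (fun x => g (f x)).
Proof.
move=> gP fP; have gl := cmor_linear gP; have fl := cmor_linear fP.
split=> [|c|c]; first by lin.
  rewrite (cmor_comul gP) (swd_morph _ fP) //; lin.
by rewrite (cmor_counit gP) (cmor_counit fP).
Qed.

Section Transport.
Variables (k : comNzRingType) (B : hopfAlgType k) (C : coalgType k).
Variables (v : B -> C) (w : C -> B).
Hypotheses (vP : coalg_morphism v) (wP : coalg_morphism w).
Hypotheses (vK : cancel v w) (wK : cancel w v).
Variables (one : C) (mul : C -> C -> C).
Hypotheses (v1 : v 1 = one) (mulE : forall x y, mul x y = v (w x * w y)).

(** A coalgebra isomorphic to a Hopf algebra inherits its structure.  The unit and
    the product are given beforehand and only known to agree with the transported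
    ones, so that they can be taken to be those of the deformation. *)
Lemma hopf_transport :
  exists (S : hopf_structure one mul) (f : B -> hopf_of S), hopf_iso f.
Proof.
have vl := cmor_linear vP; have wl := cmor_linear wP.
have w1 : w one = 1 by rewrite -v1 vK.
have mul_fun : mul = fun x y => v (w x * w y).
  by apply/funext => x; apply/funext => y.
have mul_bil : bilinear_for *:%R *:%R mul by rewrite mul_fun; lin.
pose S0 x := v (antipode (w x)).
have S0_lin : linear S0 by rewrite /S0; lin.
pose S : {linear C -> C} := HB.pack S0 (GRing.isLinear.Build _ _ _ _ S0 S0_lin).
have mulA : associative mul by move=> x y z; rewrite !mulE !vK mulrA.
have mul1l : left_id one mul by move=> x; rewrite mulE w1 mul1r wK.
have mul1r' : right_id one mul by move=> x; rewrite mulE w1 mulr1 wK.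
have comul1 : comul one = one ⊗ one.
  rewrite -v1 (cmor_comul vP) comul1 tlift_pure //; lin.
have comulM g h : comul (mul g h) =
    [swd g1, g2 <- g => [swd h1, h2 <- h => mul g1 h1 ⊗ mul g2 h2]].
  rewrite mulE (cmor_comul vP) swd_mul; last lin.
  rewrite (swd_morph _ wP); last lin.
  apply: eq_tlift => g1 g2; rewrite (swd_morph _ wP); last lin.
  by apply: eq_tlift => h1 h2; rewrite !mulE.
have cou1 : counit one = 1 by rewrite -v1 (cmor_counit vP) counit1.
have couM g h : counit (mul g h) = counit g * counit h.
  by rewrite mulE (cmor_counit vP) counitM !(cmor_counit wP).
have Sl h : [swd h1, h2 <- h => mul (S h1) h2] = counit h *: one.
  rewrite -(cmor_counit wP) -v1 -(linear_mapZ _ _ vl) -antipode_l.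
  rewrite (swd_morph _ wP); last lin.
  rewrite (linear_tlift _ _ vl).
  by apply: eq_tlift => h1 h2; rewrite mulE vK.
have Sr h : [swd h1, h2 <- h => mul h1 (S h2)] = counit h *: one.
  rewrite -(cmor_counit wP) -v1 -(linear_mapZ _ _ vl) -antipode_r.
  rewrite (swd_morph _ wP); last lin.
  rewrite (linear_tlift _ _ vl).
  by apply: eq_tlift => h1 h2; rewrite mulE vK.
exists (HopfStructure mulA mul1l mul1r' mul_bil comul1 comulM cou1 couM Sl Sr), v.
split; last by exists w.
split.
(* [C] and the coalgebra underlying [hopf_of] agree only field by field. *)
- split; [exact: cmor_linear vP | exact: cmor_comul vP | exact: cmor_counit vP].
- exact: v1.
- move=> x y; suff -> : v (x * y) = mul (v x) (v y) by [].
  by rewrite mulE !vK.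
- by move=> x; rewrite -[RHS]/(v (antipode (w (v x)))) vK.
Qed.

End Transport.

(** * Two complements of the same Hopf subalgebra *)

Section TwoComplements.
Variables (k : comNzRingType) (E A H HH : hopfAlgType k).
Variables (iA : A -> E) (iH : H -> E) (iHH : HH -> E).
Hypotheses (iAP : hopf_morphism iA) (iHP : hopf_morphism iH).
Hypothesis iHHP : hopf_morphism iHH.
Hypothesis bijH : bijective (mul_map iA iH).
Hypothesis bijHH : bijective (mul_map iA iHH).

Let iHH_lin := cmor_linear (hmor_coalg iHHP).
Let iH_lin := cmor_linear (hmor_coalg iHP).
Let projA_lin := projA_linear iAP iHP bijH.
Let projH_lin := projH_linear iAP iHP bijH.
Let pHH_lin := projH_linear iAP iHHP bijHH.

(** Project the decomposition x = u(x_(1)) v(x_(2)) to HH: the factor in A only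
    contributes its counit. *)
Lemma compl_change_K :
  cancel (fun x => projH iA iH (iHH x)) (fun h => projH iA iHH (iH h)).
Proof.
move=> x; rewrite -[RHS](projH_iH iAP iHHP bijHH).
rewrite -[in RHS](compl_decomp iAP iHP bijH (iHH x)).
rewrite (linear_tlift _ _ pHH_lin) (swd_morph _ (hmor_coalg iHHP)).
  rewrite -[LHS](@swd_counitl _ _ _
    (fun x => projH iA iHH (iH (projH iA iH (iHH x))))); last lin.
  apply: eq_tlift => x1 x2; rewrite (projH_mulA iAP iHHP bijHH).
  by rewrite (projA_counit iAP iHP bijH) (cmor_counit (hmor_coalg iHHP)).
have iA_lin := cmor_linear (hmor_coalg iAP); lin.
Qed.

End TwoComplements.

Theorem theorem2p8 (k : comNzRingType) (E A H HH : hopfAlgType k)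
  (iA : A -> E) (iH : H -> E) (iHH : HH -> E)
  (A_sub : hopf_subalgebra iA)
  (H_compl : is_complement iA iH)
  (HH_compl : is_complement iA iHH) :
  let lact := canonical_lact iA iH in
  let ract := canonical_ract iA iH in
  exists r : H -> A, deformation_map lact ract r /\
  exists (H_r : hopf_structure (1 : H) (deform_mul ract r))
         (f : HH -> hopf_of H_r),
    hopf_iso f.
Proof.
move=> lact ract.
have iAP := hsub_morphism A_sub.
have [/hsub_morphism iHP bijH] := H_compl.
have [/hsub_morphism iHHP bijHH] := HH_compl.
pose u x := projA iA iH (iHH x).
pose v x := projH iA iH (iHH x).
pose w h := projH iA iHH (iH h).
have uP : coalg_morphism u.
  exact: coalg_morphism_comp (projA_coalg iAP iHP bijH) (hmor_coalg iHHP).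
have vP : coalg_morphism v.
  exact: coalg_morphism_comp (projH_coalg iAP iHP bijH) (hmor_coalg iHHP).
have wP : coalg_morphism w.
  exact: coalg_morphism_comp (projH_coalg iAP iHHP bijHH) (hmor_coalg iHP).
have vK : cancel v w by exact: compl_change_K.
have wK : cancel w v by exact: compl_change_K.
pose r h := u (w h).
have rP : coalg_morphism r by exact: coalg_morphism_comp uP wP.
have rl := cmor_linear rP; have wl := cmor_linear wP.
have ul := cmor_linear uP; have vl := cmor_linear vP.
have MP := canonical_matched_pair iAP iHP bijH.
have ractl := ract_bilinear MP; have lactl := lact_bilinear MP.
have u1 : u 1 = 1.
  by rewrite /u (hmor_one iHHP) -(hmor_one iAP) (projA_iA iAP iHP bijH).
have v1 : v 1 = 1.
  by rewrite /v (hmor_one iHHP) -(hmor_one iHP) (projH_iH iAP iHP bijH).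
have w1 : w 1 = 1 by rewrite -v1 vK.
have vM x y : v (x * y) = deform_mul ract r (v x) (v y).
  rewrite /v (hmor_mul iHHP) (projH_mul iAP iHP bijH).
  rewrite (swd_morph _ (hmor_coalg iHHP)).
    rewrite /deform_mul -/(v y) (swd_morph _ vP); last lin.
    by apply: eq_tlift => y1 y2; rewrite /r vK.
  have projA_lin := projA_linear iAP iHP bijH.
  have projH_lin := projH_linear iAP iHP bijH.
  have iA_lin := cmor_linear (hmor_coalg iAP); lin.
have uM x y : u (x * y) = [swd x1, x2 <- x => u x1 * lact (v x2) (u y)].
  rewrite /u (hmor_mul iHHP) (projA_mul iAP iHP bijH).
  rewrite (swd_morph _ (hmor_coalg iHHP)) //.
  have projA_lin := projA_linear iAP iHP bijH.
  have projH_lin := projH_linear iAP iHP bijH.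
  have iH_lin := cmor_linear (hmor_coalg iHP); lin.
have mulE h g : deform_mul ract r h g = v (w h * w g) by rewrite vM !wK.
have uv_cocentral x :
    [swd x1, x2 <- x => u x1 ⊗ v x2] = [swd x1, x2 <- x => u x2 ⊗ v x1].
  have projA_lin := projA_linear iAP iHP bijH.
  have projH_lin := projH_linear iAP iHP bijH.
  have := proj_cocentral iAP iHP bijH (iHH x).
  by rewrite !(swd_morph _ (hmor_coalg iHHP)) //; lin.
exists r; split; last exact (hopf_transport vP wP vK wK v1 mulE).
split=> //; first by rewrite /r w1.
- move=> h; have := uv_cocentral (w h); rewrite !(swd_morph _ wP); [|lin|lin].
  suff rE (x y : H) : u (w x) ⊗ v (w y) = r x ⊗ y.
    rewrite (eq_tlift _ rE) => ->.
    by apply: eq_tlift => h1 h2; apply: rE.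
  by rewrite wK.
- move=> g h; rewrite -(linear_tlift _ _ rl) -[tlift _ _]/(deform_mul ract r h g).
  rewrite mulE /r vK uM (swd_morph _ wP); last lin.
  by apply: eq_tlift => h1 h2; rewrite wK.
Qed.
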